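(* Let $G$ be an algebra group over the finite field $\mathbb{F}_q$ and let $H$ be a subalgebra group of $G$. Suppose that (1) no two distinct superclasses of $H$ are contained in the same superclass of $G$, and (2) $x(h-1)+1\in H$ for all $x\in G$ and $h\in H$. Then for every superclass function $\chi$ of $H$, $$\mathrm{SInd}_H^G(\chi)=\mathrm{Ind}_H^G(\chi).$$
   Context: An algebra group over $\mathbb{F}_q$ is a group of the form $G=1+J=\{1+x \mid x\in J\}$, where $J$ is a finite-dimensional nilpotent associative $\mathbb{F}_q$-algebra and multiplication is $(1+x)(1+y)=1+x+y+xy$ (computed in the unital algebra $\mathbb{F}_q\cdot 1+J$). A subalgebra group of $G$ is a subgroup $H=1+J'$ with $J'\subseteq J$ a subalgebra. Two elements $u,v\in G$ are in the same superclass of $G$ if $v-1=x(u-1)y$ for some $x,y\in G$. A superclass function of $G$ is a function $G\to\mathbb{C}$ constant on superclasses of $G$; superclasses and superclass functions of $H$ are defined in the same way using $H$ in place of $G$. For a function $\chi:H\to\mathbb{C}$ let $\dot\chi:G\to\mathbb{C}$ be $\dot\chi(z)=\chi(z)$ if $z\in H$ and $\dot\chi(z)=0$ if $z\notin H$. For a superclass function $\chi$ of $H$, superinduction is $$\mathrm{SInd}_H^G(\chi)(g)=\frac{1}{|G||H|}\sum_{x,y\in G}\dot\chi\big(x(g-1)y+1\big),\qquad g\in G,$$ and induction is the usual one, $\mathrm{Ind}_H^G(\chi)(g)=\frac{1}{|H|}\sum_{y\in G}\dot\chi(y^{-1}gy)$. *)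

(* Defs.v *)
From HB Require Import structures.
From mathcomp Require Import all_boot all_order all_algebra all_field.
From mathcomp Require Import reals.
From mathcomp Require Import complex.

Set Implicit Arguments.
Unset Strict Implicit.
Unset Printing Implicit Defensive.

Import GRing.Theory.
Local Open Scope ring_scope.

(* The nilpotent algebra J has no unit, so it is presented as a subspace of a
   finite-dimensional unital algebra A; the algebra F.1 + J is then a unital
   subalgebra of A. Every finite-dimensional nilpotent algebra arises in this
   way, with A its unitization. Elements live in [finvect_type A], the library
   alias of A that carries the finite type structure. *)

Section AlgebraGroups.

Variables (F : finFieldType) (A : falgType F).

Implicit Types (J : {vspace A}) (G H : {set finvect_type A}).

(* Not {aspace A}: an aspace must contain an identity element. *)
Definition subalgebra J : bool := (J * J <= J)%VS.

Definition nilpotent_algebra J : Prop :=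
  subalgebra J /\ exists n : nat, (J ^+ n)%VS = 0%VS.

Definition algebra_group J : {set finvect_type A} :=
  [set 1 + x | x : finvect_type A in J].

Definition superclass G (u : finvect_type A) : {set finvect_type A} :=
  [set v in G | [exists x in G, exists y in G, v - 1 == x * (u - 1) * y]].

Definition superclasses G : {set {set finvect_type A}} :=
  [set superclass G u | u in G].

Variable C : fieldType.
Implicit Type chi : finvect_type A -> C.

(* A function on a subset H of A is represented by a function on A of which
   only the values on H matter. *)
Definition superclass_function H chi : Prop :=
  {in H &, forall u v, v \in superclass H u -> chi u = chi v}.

Definition ext0 H chi : finvect_type A -> C :=
  fun z => if z \in H then chi z else 0.

Definition SInd G H chi (g : finvect_type A) : C :=
  (#|G|%:R * #|H|%:R)^-1 *
    \sum_(x in G) \sum_(y in G) ext0 H chi (x * (g - 1) * y + 1).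

(* Elements of 1 + J are units of A, and their inverses in A lie in 1 + J, so
   the inverse of A is the inverse of the group. *)
Definition Ind G H chi (g : finvect_type A) : C :=
  (#|H|%:R)^-1 * \sum_(y in G) ext0 H chi (y^-1 * g * y).

End AlgebraGroups.

(* Main.v *)
(** Substituting [z = x y] turns [x (g - 1) y] into [z (u - 1)] with
    [u = y^-1 g y]. Since [H] absorbs left multiplication by [G], the element
    [v = z (u - 1) + 1] lies in [H] exactly when [u] does, and then [u] and [v]
    share a superclass of [G], hence one of [H]. The sum over [z] is therefore
    [#|G|] times the term of the induced function at [y]. *)
Require Import Defs.
From HB Require Import structures.
From mathcomp Require Import all_boot all_order all_algebra all_field.
From mathcomp Require Import reals.
From mathcomp Require Import complex.

Set Implicit Arguments.
Unset Strict Implicit.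
Unset Printing Implicit Defensive.

Import GRing.Theory.
Local Open Scope ring_scope.

(** The geometric series in [- x] stops at the exponent [n] and its sum inverts [1 + x]. *)
Lemma nilpotent_unitr1D (R : unitRingType) (x : R) (n : nat) :
  x ^+ n = 0 -> 1 + x \is a GRing.unit.
Proof.
move=> xn0; set s := \sum_(i < n) (- x) ^+ i.
have eq1 : (1 + x) * s = 1.
  have := subrX1 (- x) n; rewrite exprNn xn0 mulr0 sub0r -/s.
  by rewrite -opprD mulNr => /oppr_inj/esym; rewrite addrC.
(* [R] need not be commutative, so the right inverse [s] must be shown to be a left inverse as
   well. *)
have comm_s : GRing.comm (1 + x) s.
  apply: commr_sum => i _; apply/commrX/commrN/commr_sym.
  by apply: commrD; first exact: commr1.
by apply/unitrP; exists s; rewrite -comm_s eq1.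
Qed.

Section AlgebraGroup.

Variables (F : finFieldType) (A : falgType F).
Implicit Types (J : {vspace A}) (G H : {set finvect_type A}).

Lemma mem_expv J (x : A) n : x \in J -> x ^+ n \in (J ^+ n)%VS.
Proof.
move=> Jx; elim: n => [|n IHn]; first by rewrite expv0 expr0 memv_line.
by rewrite expvSl exprS memv_mul.
Qed.

Lemma algebra_groupE J (u : finvect_type A) :
  (u \in algebra_group J) = ((u - 1 : A) \in J).
Proof.
apply/imsetP/idP => [[x Jx ->]|Ju]; first by rewrite addrC addKr.
by exists (u - 1); rewrite // addrC subrK.
Qed.

Lemma algebra_group1 J : 1 \in algebra_group J.
Proof. by rewrite algebra_groupE subrr mem0v. Qed.

Lemma algebra_groupM J (u v : finvect_type A) :
  subalgebra J -> u \in algebra_group J -> v \in algebra_group J ->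
  u * v \in algebra_group J.
Proof.
move=> /subvP subJ; rewrite !algebra_groupE => Ju Jv.
have -> : u * v - 1 = (u - 1) * (v - 1) + (u - 1) + (v - 1).
  by rewrite mulrBr mulr1 subrK mulrBl mul1r addrA subrK.
exact: memvD (memvD (subJ _ (memv_mul Ju Jv)) Ju) Jv.
Qed.

(** Every element of [J] is nilpotent, because its [n]-th power lies in [J ^+ n], which is zero;
    this applies to [u - 1]. *)
Lemma algebra_group_unit J (u : finvect_type A) :
  nilpotent_algebra J -> u \in algebra_group J -> u \is a GRing.unit.
Proof.
move=> [_ [n Jn0]]; rewrite algebra_groupE => Ju.
rewrite -(subrK 1 u) addrC; apply: (@nilpotent_unitr1D _ _ n).
by have := mem_expv n Ju; rewrite Jn0 memv0 => /eqP.
Qed.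

(* Left multiplication by [u] is an injective self-map of a finite set, so it
   reaches 1. *)
Lemma algebra_groupV J (u : finvect_type A) :
  nilpotent_algebra J -> u \in algebra_group J -> u^-1 \in algebra_group J.
Proof.
move=> nilJ Gu; have Uu := algebra_group_unit nilJ Gu.
have im_eq : [set u * v | v in algebra_group J] = algebra_group J.
  apply/eqP; rewrite eqEcard (card_imset _ (mulrI Uu)) leqnn andbT.
  by apply/subsetP => _ /imsetP[v Gv ->]; apply: algebra_groupM => //; case: nilJ.
have := algebra_group1 J; rewrite -{1}im_eq => /imsetP[v Gv eq1].
by rewrite -[u^-1]mulr1 eq1 mulKr.
Qed.

Lemma algebra_groupS J J' : (J' <= J)%VS -> algebra_group J' \subset algebra_group J.
Proof. by move=> /subvP sJ; apply: imsetS; apply/subsetP => x /sJ. Qed.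

Lemma superclass_refl G (u : finvect_type A) :
  1 \in G -> u \in G -> u \in superclass G u.
Proof.
move=> G1 Gu; rewrite inE Gu /=; apply/existsP; exists 1; rewrite G1 /=.
by apply/existsP; exists 1; rewrite G1 mul1r mulr1 eqxx.
Qed.

(** The factor [z] is absorbed on the left: [x * (v - 1) * y = (x * z) * (u - 1) * y]. Taking
    [z = 1] compares the superclasses of one element in [H] and in the larger group. *)
Lemma superclass_sub_mulL J H (z u v : finvect_type A) :
  subalgebra J -> H \subset algebra_group J -> z \in algebra_group J ->
  v - 1 = z * (u - 1) ->
  superclass H v \subset superclass (algebra_group J) u.
Proof.
move=> subJ /subsetP sHG Gz eqv; apply/subsetP => w; rewrite !inE.
case/andP=> Hw /existsP[x /andP[Hx /existsP[y /andP[Hy /eqP eqw]]]].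
rewrite sHG //=; apply/existsP; exists (x * z).
rewrite algebra_groupM ?(sHG x Hx) //=; apply/existsP; exists y.
by rewrite sHG //= eqw eqv !mulrA.
Qed.

(** Right translation by [y^-1] permutes the group. This is the change of variable [x = z * y^-1]
    for a fixed [y]. *)
Lemma reindex_algebra_groupMr J (C : nmodType) (y : finvect_type A)
    (f : finvect_type A -> C) :
  nilpotent_algebra J -> y \in algebra_group J ->
  \sum_(x in algebra_group J) f x = \sum_(z in algebra_group J) f (z * y^-1).
Proof.
move=> nilJ Gy; have Uy := algebra_group_unit nilJ Gy.
have subJ : subalgebra J by case: nilJ.
have GV := algebra_groupV nilJ Gy.
have UV : y^-1 \is a GRing.unit by rewrite unitrV.
rewrite (reindex_inj (mulIr UV)) /=; apply: eq_bigl => z.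
apply/idP/idP => Gz; last exact: algebra_groupM.
by rewrite -(mulrVK Uy z); apply: algebra_groupM.
Qed.

End AlgebraGroup.

Theorem theorem3p1 (R : realType) (F : finFieldType) (A : falgType F)
  (J J' : {vspace A}) (G H : {set finvect_type A})
  (nilJ : nilpotent_algebra J) (subJ' : subalgebra J') (sJ'J : (J' <= J)%VS)
  (defG : G = algebra_group J) (defH : H = algebra_group J')
  (separated : forall K K1 K2 : {set finvect_type A},
     K \in superclasses G -> K1 \in superclasses H -> K2 \in superclasses H ->
     K1 \subset K -> K2 \subset K -> K1 = K2)
  (absorbing : {in G & H, forall x h, x * (h - 1) + 1 \in H}) :
  forall chi : finvect_type A -> R[i],
    superclass_function H chi -> {in G, SInd G H chi =1 Ind G H chi}.
Proof.
move=> chi chiH g _.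
have subJ : subalgebra J by case: nilJ.
have H1 : 1 \in H by rewrite defH algebra_group1.
have G1 : 1 \in G by rewrite defG algebra_group1.
have GM : {in G &, forall x y, x * y \in G}.
  by rewrite defG => x y; apply: algebra_groupM.
have GU : {in G, forall x, x \is a GRing.unit}.
  by rewrite defG => x; apply: algebra_group_unit.
have GV : {in G, forall x, x^-1 \in G}.
  by rewrite defG => x; apply: algebra_groupV.
have sHG : H \subset G by rewrite defG defH algebra_groupS.
have ext0_mulL z u : z \in G -> ext0 H chi (z * (u - 1) + 1) = ext0 H chi u.
  move=> Gz; rewrite /ext0; set v := z * (u - 1) + 1.
  have eqv : v - 1 = z * (u - 1) by rewrite addrK.
  have equ : u = z^-1 * (v - 1) + 1 by rewrite eqv mulKr ?GU // subrK.
  (* If [v] is in [H], absorption with [z^-1] puts [u] in [H]; so when [u] is outside [H], both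
     values are 0. *)
  have [Hu|nHu] := boolP (u \in H); last first.
    case: ifP => // Hv; case/negP: nHu.
    by rewrite equ absorbing // GV.
  have Hv : v \in H by apply: absorbing.
  rewrite Hv; apply/esym/chiH => //.
  suff -> : superclass H u = superclass H v by apply: superclass_refl.
  (* The superclass of [u] in [G] contains both superclasses of [H]: that of [u] through the factor
     1, that of [v] through the factor [z]. *)
  apply: (separated (superclass G u)); rewrite ?imset_f ?(subsetP sHG) //.
    rewrite defG; apply: (superclass_sub_mulL subJ (z := 1)).
    - by rewrite -defG.
    - exact: algebra_group1.
    - by rewrite mul1r.
  by rewrite defG; apply: (superclass_sub_mulL subJ (z := z)); rewrite -?defG.
(* In characteristic 0 the order of [G] is invertible, so it cancels against the normalization of
   [SInd]. *)
have G_neq0 : #|G|%:R != 0 :> R[i].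
  by rewrite Num.Theory.pnatr_eq0 -lt0n; apply/card_gt0P; exists 1.
(* The substitution for [x] depends on [y], so the sum over [y] must be the outer one. *)
rewrite /SInd /Ind exchange_big /=.
have -> : \sum_(y in G) \sum_(x in G) ext0 H chi (x * (g - 1) * y + 1)
  = #|G|%:R * \sum_(y in G) ext0 H chi (y^-1 * g * y).
  rewrite mulr_sumr; apply: eq_bigr => y Gy.
  (* The factor [#|G|] is spread out as a constant sum over [G], to be matched term by term with the
     sum over [z]. *)
  rewrite mulr_natl -sumr_const defG.
  rewrite [LHS](reindex_algebra_groupMr (y := y) _ nilJ) -?defG //.
  apply: eq_bigr => z Gz; rewrite -[RHS](ext0_mulL z) //.
  congr (ext0 _ _ (_ + 1)).
  by rewrite -!mulrA; congr (z * _); rewrite mulrBl mul1r mulrBr mulVr ?GU.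
by rewrite invfM mulrCA !mulrA mulfV // mul1r.
Qed.
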